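(* Let $(W,S)$ be an odd-angled Coxeter system such that the divisibility diagram $\mathrm{Cox}_{\mathrm{div}}(W)$ is connected. Suppose that $V\subsetneq W$ is a reflection subgroup of index $n$, where $1<n<\infty$. Let $W_1$ be a special subgroup of $W$, i.e. the subgroup generated by a nonempty subset $S_1\subset S$. Then $W_1$ (regarded as a Coxeter group with generating set $S_1$) contains a proper reflection subgroup of index at most $n$.
   Context: A Coxeter system $(W,S)$ consists of a nonempty finite set $S=\{s_1,\dots,s_r\}$ and the group $W=\langle S\mid (s_is_j)^{m_{ij}}=1\ \forall i,j\rangle$, where $m_{ii}=1$ and $m_{ij}=m_{ji}\in\{2,3,4,\dots\}\cup\{\infty\}$ for $i\ne j$ ($m_{ij}=\infty$ means no relation is imposed on $s_is_j$). It is odd-angled if every $m_{ij}$ with $i\neq j$ is odd or infinite. A reflection of $W$ is an element conjugate in $W$ to an element of $S$. A reflection subgroup is a proper subgroup (index greater than $1$) generated by reflections; the trivial subgroup counts as generated by the empty set of reflections. The divisibility diagram $\mathrm{Cox}_{\mathrm{div}}(W)$ is the graph with vertices $v_i$ corresponding to $s_i\in S$; distinct $v_i,v_j$ are joined by an edge labeled by the smallest divisor $k>1$ of $m_{ij}$ if $m_{ij}<\infty$, and are not joined if $m_{ij}=\infty$. *)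

(* Defs.v *)
From HB Require Import structures.
From mathcomp Require Import all_boot generic_quotient.
From mathcomp Require Import boolp classical_sets functions cardinality.

Set Implicit Arguments.
Unset Strict Implicit.
Unset Printing Implicit Defensive.

Local Open Scope quotient_scope.
Local Open Scope group_scope.
Local Open Scope classical_set_scope.
Local Open Scope card_scope.

Section PresentedGroup.
Variables (X : choiceType) (R : set (seq (X * bool))).

(* The letter (x, true) stands for the generator x, (x, false) for its inverse. *)
Inductive word_eq : seq (X * bool) -> seq (X * bool) -> Prop :=
| word_eq_refl u : word_eq u u
| word_eq_sym u v : word_eq u v -> word_eq v u
| word_eq_trans v u w : word_eq u v -> word_eq v w -> word_eq u w
| word_eq_cat u u' v v' :
    word_eq u u' -> word_eq v v' -> word_eq (u ++ v) (u' ++ v')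
| word_eq_cancel x b : word_eq [:: (x, b); (x, ~~ b)] [::]
| word_eq_relator r : R r -> word_eq r [::].

Definition word_eqb : rel (seq (X * bool)) := fun u v => `[< word_eq u v >].

Lemma word_eqb_equiv : equiv_class_of word_eqb.
Proof.
split=> [u|u v|v u w]; rewrite /word_eqb.
- exact/asboolP/word_eq_refl.
- by apply/asboolP/asboolP; apply: word_eq_sym.
- by move=> /asboolP uv /asboolP vw; apply/asboolP/(word_eq_trans uv vw).
Qed.

Canonical word_equiv := EquivRelPack word_eqb_equiv.

(* The group < X | r = 1 for r in R >. *)
Definition presented := {eq_quot word_equiv}.

HB.instance Definition _ := Choice.on presented.

Definition presented_of_word (u : seq (X * bool)) : presented := \pi_presented u.

Lemma presented_of_wordP u v :
  presented_of_word u = presented_of_word v <-> word_eq u v.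
Proof.
rewrite /presented_of_word; split.
- by move/eqquotP => /asboolP.
- by move=> uv; apply/eqquotP/asboolP.
Qed.

Lemma presented_of_wordK w : presented_of_word (repr w) = w.
Proof. exact: reprK. Qed.

Definition inv_word (u : seq (X * bool)) := rev [seq (l.1, ~~ l.2) | l <- u].

Lemma inv_word_cat u v : inv_word (u ++ v) = inv_word v ++ inv_word u.
Proof. by rewrite /inv_word map_cat rev_cat. Qed.

Lemma inv_wordK : involutive inv_word.
Proof.
move=> u; rewrite /inv_word map_rev revK -map_comp map_id_in // => -[x b] _ /=.
by rewrite negbK.
Qed.

Lemma word_eq_mulV u : word_eq (u ++ inv_word u) [::].
Proof.
elim: u => [|[x b] u IH]; first exact: word_eq_refl.
rewrite -cat1s inv_word_cat -catA [u ++ _]catA.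
apply: (word_eq_trans _ (word_eq_cancel x b)).
rewrite -[[:: (x, b); _]]/([:: (x, b)] ++ ([::] ++ [:: (x, ~~ b)])).
apply/word_eq_cat; first exact: word_eq_refl.
by apply/word_eq_cat => //; exact: word_eq_refl.
Qed.

Lemma word_eq_Vmul u : word_eq (inv_word u ++ u) [::].
Proof. by have := word_eq_mulV (inv_word u); rewrite inv_wordK. Qed.

Lemma word_eq_inv u v : word_eq u v -> word_eq (inv_word u) (inv_word v).
Proof.
move=> uv; have {}uv := word_eq_sym uv.
apply: (@word_eq_trans (inv_word u ++ v ++ inv_word v)).
  rewrite -{1}[inv_word u]cats0; apply: word_eq_cat; first exact: word_eq_refl.
  exact/word_eq_sym/word_eq_mulV.
rewrite catA -{2}[inv_word v]cat0s; apply: word_eq_cat; last exact: word_eq_refl.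
apply: (word_eq_trans _ (word_eq_Vmul u)).
by apply: word_eq_cat => //; exact: word_eq_refl.
Qed.

Definition presented_one : presented := presented_of_word [::].
Definition presented_mul (a b : presented) : presented :=
  presented_of_word (repr a ++ repr b).
Definition presented_inv (a : presented) : presented :=
  presented_of_word (inv_word (repr a)).

Lemma word_eq_repr u : word_eq (repr (presented_of_word u)) u.
Proof. by apply/presented_of_wordP; rewrite presented_of_wordK. Qed.

Lemma presented_of_word_cat u v :
  presented_of_word (u ++ v) =
  presented_mul (presented_of_word u) (presented_of_word v).
Proof.
by apply/presented_of_wordP/word_eq_cat; apply/word_eq_sym/word_eq_repr.
Qed.

Lemma presented_of_word_inv u :
  presented_of_word (inv_word u) = presented_inv (presented_of_word u).
Proof.
by apply/presented_of_wordP/word_eq_inv/word_eq_sym/word_eq_repr.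
Qed.

Lemma presented_mulA : associative presented_mul.
Proof.
move=> a b c.
rewrite -[a]presented_of_wordK -[b]presented_of_wordK -[c]presented_of_wordK.
by rewrite -!presented_of_word_cat catA.
Qed.

Lemma presented_1mul : left_id presented_one presented_mul.
Proof.
by move=> a; rewrite -[a]presented_of_wordK -presented_of_word_cat cat0s.
Qed.

Lemma presented_mul1 : right_id presented_one presented_mul.
Proof.
by move=> a; rewrite -[a]presented_of_wordK -presented_of_word_cat cats0.
Qed.

Lemma presented_Vmul : left_inverse presented_one presented_inv presented_mul.
Proof.
move=> a; rewrite -[a]presented_of_wordK -presented_of_word_inv.
by rewrite -presented_of_word_cat; apply/presented_of_wordP/word_eq_Vmul.
Qed.

Lemma presented_mulV : right_inverse presented_one presented_inv presented_mul.
Proof.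
move=> a; rewrite -[a]presented_of_wordK -presented_of_word_inv.
by rewrite -presented_of_word_cat; apply/presented_of_wordP/word_eq_mulV.
Qed.

HB.instance Definition _ := isGroup.Build presented presented_mulA
  presented_1mul presented_mul1 presented_Vmul presented_mulV.

Definition presented_gen (x : X) : presented := presented_of_word [:: (x, true)].

End PresentedGroup.

Section Subgroups.
Variable W : groupType.

Definition is_subgroup (H : set W) : Prop :=
  [/\ H 1, forall x y, H x -> H y -> H (x * y) & forall x, H x -> H x^-1].

Definition generated (A : set W) : set W := smallest is_subgroup A.

Definition left_coset (x : W) (V : set W) : set W := [set x * v | v in V].

Definition has_index (V G : set W) (n : nat) : Prop :=
  V `<=` G /\ [set left_coset x V | x in G] #= `I_n.

Definition reflections (G A : set W) : set W :=
  [set a ^ g | a in A & g in G].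

(* G is the Coxeter group, A its set of Coxeter generators. *)
Definition reflection_subgroup (G A V : set W) : Prop :=
  V `<` G /\ exists2 T : set W, T `<=` reflections G A & V = generated T.

End Subgroups.

(* The entry None stands for infinity. *)
Record coxeter_matrix (S : finType) := CoxeterMatrix {
  cox_entry :> S -> S -> option nat;
  cox_diag : forall i, cox_entry i i = Some 1%N;
  cox_sym : forall i j, cox_entry i j = cox_entry j i;
  cox_offdiag : forall i j k, i != j -> cox_entry i j = Some k -> (2 <= k)%N
}.

Section Coxeter.
Variables (S : finType) (m : coxeter_matrix S).

Definition coxeter_relators : set (seq (S * bool)) :=
  [set r | exists i j k, m i j = Some k /\
     r = flatten (nseq k [:: (i, true); (j, true)])].

Definition coxeter_group : groupType := presented coxeter_relators.

Definition coxeter_gen (i : S) : coxeter_group :=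
  presented_gen coxeter_relators i.

Definition coxeter_gens (S1 : {set S}) : set coxeter_group :=
  [set coxeter_gen i | i in [set` S1]].

Definition special_subgroup (S1 : {set S}) : set coxeter_group :=
  generated (coxeter_gens S1).

Definition odd_angled : Prop :=
  forall i j k, i != j -> m i j = Some k -> odd k.

(* Edge labels of the divisibility diagram, None meaning that there is no edge;
   for k > 1 the smallest divisor of k greater than 1 is its smallest prime
   divisor [pdiv k]. *)
Definition cox_div (i j : S) : option nat :=
  if i == j then None else omap pdiv (m i j).

Definition cox_div_connected : Prop :=
  forall i j, connect (fun i j => isSome (cox_div i j)) i j.

End Coxeter.

Arguments coxeter_gens {S} m S1 _.
Arguments special_subgroup {S} m S1 _.

(* Main.v *)
Require Import Defs.
From mathcomp Require Import all_boot.
From mathcomp Require Import generic_quotient boolp cardinality.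
From mathcomp Require Import classical_sets.

(** The intersection of a reflection subgroup with a special subgroup is again
    generated by reflections, so a suitable conjugate of V meets W_1 in a
    reflection subgroup of W_1, and W_1 has at most n cosets modulo it.

    Conjugating is needed only to make the intersection proper.  Where m i j is
    odd, s_i and s_j are conjugate ([odd_gen_conj]); connectedness of the
    divisibility diagram then makes all generators conjugate ([gen_conj]).  If
    every conjugate of V contained a given s_i with i in S_1, then V would
    contain all generators and be W.  So some conjugate V' of V misses
    s_i, and V' meets W_1 in a proper subgroup.  Mapping the coset of x to
    x g V, where V' = g V g^-1, embeds W_1 / (V' `&` W_1) into W / V
    ([has_index_setI]).

    That V' `&` W_1 is generated by reflections of W_1
    ([special_reflection_generated]) rests on the reflection cocycle.  Reading
    a word as a gallery of chambers, it crosses a sequence of walls, each fixed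
    by a reflection; the parity with which a given reflection r occurs depends
    only on the element w that the word represents, because it does not change
    under the Coxeter relations ([odd_count_crossed]).  This parity is
    [crosses w r].

    Let v be an element of V' `&` W_1 and u a word in S_1 for it.  If u crosses
    the wall of a reflection r in V', then r is a reflection of W_1, and u with
    one letter deleted represents r v; induct on the length of u.  Otherwise v
    crosses no wall of a reflection of V', and then v = 1
    ([uncrossed_eq1]): V' is generated by the reflections in the walls of its
    own fundamental chamber ([sub_wall_product]), and the exchange argument for
    these generators shortens any product of them that crosses no wall of V',
    down to the empty product. *)

Set Implicit Arguments.
Unset Strict Implicit.
Unset Printing Implicit Defensive.

Local Open Scope group_scope.
Local Open Scope classical_set_scope.
Local Open Scope card_scope.

(** * Subgroups and cosets *)

Section GeneratedSubgroup.
Variable W : groupType.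
Implicit Types (A H : set W).

Lemma sub_generated A : A `<=` generated A.
Proof. exact: sub_gen_smallest. Qed.

Lemma generated_sub A H : is_subgroup H -> A `<=` H -> generated A `<=` H.
Proof. exact: smallest_sub. Qed.

Lemma is_subgroup_generated A : is_subgroup (generated A).
Proof.
split.
- by move=> H [[]].
- move=> x y Gx Gy H HA; have [[_ HM _] _] := HA.
  by apply: HM; [apply: Gx|apply: Gy].
- by move=> x Gx H HA; have [[_ _ HV] _] := HA; apply: HV; apply: Gx.
Qed.

Lemma is_subgroup_setI H K :
  is_subgroup H -> is_subgroup K -> is_subgroup (H `&` K).
Proof.
move=> [H1 HM HV] [K1 KM KV]; split=> //.
- by move=> x y [Hx Kx] [Hy Ky]; split; [apply: HM|apply: KM].
- by move=> x [Hx Kx]; split; [apply: HV|apply: KV].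
Qed.

Lemma is_subgroup_conj H (g : W) :
  is_subgroup H -> is_subgroup [set x | H (x ^ g)].
Proof.
move=> [H1 HM HV]; split=> /=.
- by rewrite conj1g.
- by move=> x y Hx Hy; rewrite conjMg; apply: HM.
- by move=> x Hx; rewrite conjVg; apply: HV.
Qed.

Lemma subgroup_conj H (x y : W) : is_subgroup H -> H x -> H y -> H (x ^ y).
Proof.
move=> [_ HM HV] Hx Hy.
by rewrite conjgE; apply: (HM); [exact: HV|exact: HM].
Qed.

Lemma left_coset_eqP H (x y : W) : is_subgroup H ->
  left_coset x H = left_coset y H <-> H (x^-1 * y).
Proof.
move=> [H1 HM HV]; split.
  move=> xy; have : left_coset y H y by exists 1 => //; rewrite mulg1.
  by rewrite -xy => -[v Hv <-]; rewrite mulKg.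
move=> Hxy; apply/seteqP; split=> z [v Hv <-].
  exists ((x^-1 * y)^-1 * v); first by apply: HM => //; apply: HV.
  by rewrite invgM invgK -!mulgA mulVKg.
exists ((x^-1 * y) * v); first exact: HM.
by rewrite -!mulgA mulVKg.
Qed.

(** The cosets of [g V g^-1 `&` G] in [G] embed into those of [V], by sending
    [x (g V g^-1 `&` G)] to [x g V]; no representatives have to be chosen, as
    multiplying the whole coset by [g V] on the right gives [x g V]. *)
Lemma has_index_setI (V G : set W) (g : W) (n : nat) :
  is_subgroup V -> is_subgroup G -> has_index V setT n ->
  exists2 k, has_index ([set w | V (w ^ g)] `&` G) G k & (k <= n)%N.
Proof.
move=> Vsub Gsub [_ Vn]; set U := _ `&` G.
have Usub : is_subgroup U.
  by apply: is_subgroup_setI => //; apply: is_subgroup_conj.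
pose f (C : set W) := [set x * g * v | x in C & v in V].
have fE x : f (left_coset x U) = left_coset (x * g) V.
  have [V1 VM VV] := Vsub; apply/seteqP.
  split=> [_ [_ [u [Vu _] <-] [v Vv <-]]|].
    by exists (u ^ g * v); [apply: VM|rewrite conjgE !mulgA mulgK].
  move=> _ [v Vv <-]; exists x; last by exists v.
  by exists 1; [have [] := Usub|rewrite mulg1].
have UV : [set left_coset x U | x in G] #<=
          [set left_coset x V | x in [set: W]].
  have [|f'] := (injfunPex (A := [set left_coset x U | x in G])
    (B := [set left_coset x V | x in [set: W]])).2; last exact: inj_card_le f'.
  exists f => [_ [x Gx <-]|]; first by exists (x * g); rewrite ?fE.
  move=> _ _ /set_mem[x Gx <-] /set_mem[y Gy <-].
  rewrite !fE => /(left_coset_eqP _ _ Vsub) Vxy.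
  apply/(left_coset_eqP _ _ Usub); have [_ GM GV] := Gsub.
  split; last by apply: GM => //; apply: GV.
  by move: Vxy; rewrite /= conjgE invgM -!mulgA.
have UG : [set left_coset x U | x in G] #<= `I_n.
  by rewrite -(card_le_eqr Vn).
have Ufin : finite_set [set left_coset x U | x in G].
  exact: card_le_finite UG (finite_II n).
have [k Uk] := Ufin; exists k; first by split=> //; apply: subIsetr.
by rewrite -card_le_II -(card_le_eql Uk).
Qed.

End GeneratedSubgroup.

(** * The reflection cocycle of a Coxeter group *)

Section CoxeterGroup.
Variables (S : finType) (m : coxeter_matrix S).
Notation W := (coxeter_group m).
Notation s := (coxeter_gen m).
Implicit Types (u v p q : seq S) (w x y r t c d : W) (V : set W).

Definition eval u : W := foldr (fun i w => s i * w) 1 u.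

(** For [u = i_1 ... i_k], the reflections
    [s i_1 ... s i_(l-1) * s i_l * s i_(l-1) ... s i_1], one for each letter:
    these are the reflections in the walls that the gallery [u] crosses, in
    order and with repetitions. *)
Fixpoint crossed u : seq W :=
  if u is i :: u' then s i :: [seq r ^ s i | r <- crossed u'] else [::].

Lemma gen2 i : s i * s i = 1.
Proof.
rewrite -[LHS](presented_of_word_cat _ [:: (i, true)] [:: (i, true)]).
apply/presented_of_wordP/word_eq_relator.
by exists i, i, 1%N; rewrite cox_diag.
Qed.

Lemma genV i : (s i)^-1 = s i.
Proof. by apply: (mulgI (s i)); rewrite mulgV gen2. Qed.

Lemma eval_cat u v : eval (u ++ v) = eval u * eval v.
Proof. by elim: u => [|i u IH] /=; rewrite ?mul1g // IH mulgA. Qed.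

Lemma eval_rev u : eval (rev u) = (eval u)^-1.
Proof.
elim: u => [|i u IH] /=; first by rewrite invg1.
by rewrite rev_cons -cats1 eval_cat IH invgM /= mulg1 genV.
Qed.

Lemma eval_letters (a : seq (S * bool)) :
  eval [seq l.1 | l <- a] = presented_of_word (coxeter_relators m) a.
Proof.
elim: a => [//|[i b] a IH] /=; rewrite IH.
rewrite -cat1s presented_of_word_cat; congr (_ * _).
case: b => //; rewrite -[LHS]genV.
by rewrite -[LHS](presented_of_word_inv _ [:: (i, true)]).
Qed.

(** Generators being involutions, the signs of the letters can be dropped. *)
Definition word_of w := [seq l.1 | l <- repr w].

Lemma word_ofK w : eval (word_of w) = w.
Proof. by rewrite eval_letters presented_of_wordK. Qed.

Lemma crossed_cat u v :
  crossed (u ++ v) = crossed u ++ [seq r ^ (eval u)^-1 | r <- crossed v].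
Proof.
elim: u => [|i u IH] /=.
  by rewrite -[LHS]map_id; apply: eq_map => r; rewrite invg1 conjg1.
rewrite IH map_cat -map_comp; congr (_ :: _ ++ _).
by apply: eq_map => r /=; rewrite invgM conjgM genV.
Qed.

Lemma count_crossed_cat u v r :
  count_mem r (crossed (u ++ v)) =
  (count_mem r (crossed u) + count_mem (r ^ eval u)%g (crossed v))%N.
Proof.
rewrite crossed_cat count_cat count_map; congr (_ + _)%N.
by apply: eq_count => t /=; rewrite (can2_eq (conjgKV _) (conjgK _)).
Qed.

Definition dihedral_word (i j : S) k := flatten (nseq k [:: i; j]).

(** The reflections crossed by [(i j)^k] are enumerated by the powers of the
    rotation [s i * s j]: conjugating by it the [l]-th one gives the
    [l + 2]-nd. *)
Lemma crossed_dihedral i j k : crossed (dihedral_word i j k) =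
  [seq (s i * s j) ^+ l * s i | l <- iota 0 (k + k)].
Proof.
elim: k => [//|k IH]; rewrite addSn addnS.
rewrite /dihedral_word /= -/(dihedral_word i j k) IH.
rewrite expg0 mul1g expg1 conjgE genV -!map_comp.
congr [:: _, _ & _]; first by rewrite mulgA.
rewrite -[2%N]addn0 iotaDl -map_comp; apply: eq_map => l /=.
by rewrite !conjgE !genV expgS expgSr -!mulgA.
Qed.

(** The two halves of the list of crossed reflections agree once
    [(s i * s j) ^+ k = 1], so every reflection is crossed an even number of
    times. *)
Lemma even_crossed_dihedral i j k r : (s i * s j) ^+ k = 1 ->
  ~~ odd (count_mem r (crossed (dihedral_word i j k))).
Proof.
move=> ijk; rewrite crossed_dihedral iotaD map_cat add0n.
have -> : iota k k = [seq (k + l)%N | l <- iota 0 k] by rewrite -iotaDl addn0.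
rewrite -map_comp.
rewrite [X in _ ++ X](_ : _ = [seq (s i * s j) ^+ l * s i | l <- iota 0 k]).
  by rewrite count_cat addnn odd_double.
by apply: eq_map => l /=; rewrite expgnDr ijk mul1g.
Qed.

Lemma eval_dihedral i j k : eval (dihedral_word i j k) = (s i * s j) ^+ k.
Proof.
elim: k => [//|k IH].
by rewrite /dihedral_word /= -/(dihedral_word i j k) IH expgS mulgA.
Qed.

Lemma gen_relation i j k : m i j = Some k -> (s i * s j) ^+ k = 1.
Proof.
move=> mij; rewrite -eval_dihedral.
rewrite (_ : dihedral_word i j k =
  [seq l.1 | l <- flatten (nseq k [:: (i, true); (j, true)])]); last first.
  by rewrite map_flatten map_nseq.
rewrite eval_letters; apply/presented_of_wordP/word_eq_relator.
by exists i, j, k.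
Qed.

(** Applying a relation changes no crossing parity: cancelling [s i * s i]
    removes two equal reflections, and removing a dihedral relator removes
    each reflection an even number of times. *)
Lemma odd_count_crossed (a b : seq (S * bool)) r :
  word_eq (coxeter_relators m) a b ->
  odd (count_mem r (crossed [seq l.1 | l <- a])) =
  odd (count_mem r (crossed [seq l.1 | l <- b])).
Proof.
move=> ab; elim: ab r => {a b}.
- by [].
- by move=> a b _ IH r; rewrite IH.
- by move=> a b c _ IH1 _ IH2 r; rewrite IH1.
- move=> a a' b b' aa' IH1 _ IH2 r.
  rewrite !map_cat !count_crossed_cat !oddD IH1 IH2 !eval_letters.
  by have /presented_of_wordP -> := aa'.
- move=> i b r /=; rewrite conjgE mulKg.
  by rewrite addn0 addnn odd_double.
- move=> _ [i [j [k [mij ->]]]] r; rewrite map_flatten map_nseq /=.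
  exact/negbTE/even_crossed_dihedral/gen_relation.
Qed.

(** Whether the wall of the reflection [r] separates the fundamental chamber
    from its image under [w]. *)
Definition crosses w r := odd (count_mem r (crossed (word_of w))).

Lemma crosses_eval u r : crosses (eval u) r = odd (count_mem r (crossed u)).
Proof.
rewrite /crosses /word_of.
have -> : u = [seq l.1 | l <- [seq (i, true) | i <- u]].
  by rewrite -map_comp map_id.
apply: odd_count_crossed; apply/presented_of_wordP.
by rewrite presented_of_wordK eval_letters.
Qed.

Lemma crossesM x y r : crosses (x * y) r = crosses x r (+) crosses y (r ^ x).
Proof.
rewrite -[x]word_ofK -[y]word_ofK -eval_cat !crosses_eval.
by rewrite count_crossed_cat oddD.
Qed.

Lemma crosses1 r : crosses 1 r = false.
Proof. exact: (crosses_eval [::]). Qed.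

Lemma crosses_gen i r : crosses (s i) r = (r == s i).
Proof.
rewrite -[s i]mulg1 (crosses_eval [:: i]) /= addn0 mulg1 eq_sym.
by case: eqP.
Qed.

Lemma crossesV x r : crosses x^-1 r = crosses x (r ^ x^-1).
Proof.
have := crossesM x^-1 x r; rewrite mulVg crosses1.
by case: crosses; case: crosses.
Qed.

Lemma crossedP u r : r \in crossed u ->
  exists p i q, u = p ++ i :: q /\ r = s i ^ (eval p)^-1.
Proof.
elim: u r => [//|j u IH] r /=; rewrite inE => /orP[/eqP ->|].
  by exists [::], j, u; rewrite invg1 conjg1.
move=> /mapP[t /IH[p [i [q [-> ->]]]] ->].
by exists (j :: p), i, q; rewrite /= invgM conjgM genV.
Qed.

(** Reflecting the rest of a gallery in one of its walls deletes a letter. *)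
Lemma eval_delete p i q :
  eval (p ++ i :: q) = s i ^ (eval p)^-1 * eval (p ++ q).
Proof. by rewrite !eval_cat /= conjgE invgK !mulgA mulgVK. Qed.

(** * Canonical generators of a subgroup generated by reflections *)

Definition reflection_set :=
  reflections setT (coxeter_gens m (finset.setTfor S)).

(** Unlike [reflection_subgroup], this allows [V] to be the whole group and
    names no generating set, which makes it stable under conjugation. *)
Definition reflection_generated V :=
  is_subgroup V /\ V `<=` generated (V `&` reflection_set).

Lemma reflectionP t : reflection_set t <-> exists p i, t = s i ^ (eval p)^-1.
Proof.
split=> [[_ [i _ <-] [g _ <-]]|[p [i ->]]].
  by exists (word_of g^-1), i; rewrite word_ofK invgK.
by exists (s i); [exists i => //=; rewrite inE|exists (eval p)^-1].
Qed.

Lemma conj_gen2 i w : s i ^ w * s i ^ w = 1.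
Proof. by rewrite -conjMg gen2 conj1g. Qed.

Section Walls.
Variables (V : set W) (V_gen : reflection_generated V).

(** The reflections in the walls of the chamber of [V] that contains the
    fundamental chamber of the Coxeter group: the wall of [c] is the only wall
    of [V] between the fundamental chamber and its image under [c].  These are
    Dyer's canonical generators of [V]. *)
Definition wall c :=
  [/\ V c, c * c = 1 & forall r, V r -> crosses c r = (r == c)].

Notation prodg := (foldr (fun c w => c * w) 1).

Definition wall_product w := exists2 cs : seq W,
  (forall c, c \in cs -> wall c) & w = prodg cs.

Lemma wall_wall_product c : wall c -> wall_product c.
Proof.
move=> cw; exists [:: c]; last by rewrite /= mulg1.
by move=> d; rewrite inE => /eqP ->.
Qed.

Lemma is_subgroup_wall_product : is_subgroup wall_product.
Proof.
have mulP x y : wall_product x -> wall_product y -> wall_product (x * y).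
  move=> [cs csw ->] [ds dsw ->]; exists (cs ++ ds).
    by move=> c; rewrite mem_cat => /orP[/csw|/dsw].
  by elim: cs {csw} => [|c cs IH] /=; rewrite ?mul1g // -mulgA IH.
split=> //; first by exists [::].
move=> _ [cs csw ->]; elim: cs csw => [|c cs IH] csw /=.
  by rewrite invg1; exists [::].
have cw : wall c by apply: csw; rewrite mem_head.
rewrite invgM; apply: mulP.
  by apply: IH => d dcs; apply: csw; rewrite in_cons dcs orbT.
have [_ c2 _] := cw.
have -> : c^-1 = c by apply: (mulgI c); rewrite mulgV c2.
exact: wall_wall_product.
Qed.

(** The gallery of [P * s i * P^-1], for [P = eval p], goes along [p], crosses
    the wall of [t = s i ^ P^-1] and returns along the mirror image of [p]
    under [t].  As [t] permutes the walls of [V], no wall of [V] is crossed on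
    the way back either. *)
Lemma reflection_wall p i : V (s i ^ (eval p)^-1) ->
  (forall r, r \in crossed p -> ~ V r) -> wall (s i ^ (eval p)^-1).
Proof.
move=> Vt pV; set P := eval p; set t := s i ^ P^-1 in Vt *.
have [Vsub _] := V_gen.
have pF r : V r -> crosses P r = false.
  move=> Vr; rewrite crosses_eval; case: (boolP (r \in crossed p)) => [/pV//|].
  by move/count_memPn ->.
have tE : t = P * s i * P^-1 by rewrite /t conjgE invgK mulgA.
split=> //; first exact: conj_gen2.
move=> r Vr; rewrite {1}tE !crossesM pF //= crosses_gen crossesV.
rewrite -!conjgM -tE pF ?addbF.
  by rewrite (can2_eq (conjgK _) (conjgKV _)).
exact: subgroup_conj.
Qed.

(** By induction on [p]: if [p] crosses the wall of a reflection [r] of [V],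
    then both [r] and the conjugate of [s i ^ (eval p)^-1] by [r] arise from
    shorter words; otherwise [reflection_wall] applies. *)
Lemma reflection_wall_product p i :
  V (s i ^ (eval p)^-1) -> wall_product (s i ^ (eval p)^-1).
Proof.
have [n] := ubnP (size p); elim: n => // n IH in p i *; rewrite ltnS => pn Vt.
have [Vsub _] := V_gen.
have [[r [/crossedP[p1 [j [p2 [pE ->]]]] Vr]]|none] :=
  pselect (exists r, r \in crossed p /\ V r); last first.
  apply/wall_wall_product/reflection_wall => // r rp Vr.
  by apply: none; exists r.
have sz : (size (p1 ++ p2) < n)%N.
  by move: pn; rewrite pE !size_cat /= addnS.
have tE : s i ^ (eval p)^-1 =
          (s i ^ (eval (p1 ++ p2))^-1) ^ (s j ^ (eval p1)^-1).
  rewrite -conjgM pE eval_delete invgM.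
  congr (_ ^ (_ * _)); apply: (mulgI (s j ^ (eval p1)^-1)).
  by rewrite mulgV conj_gen2.
rewrite tE; apply: subgroup_conj; first exact: is_subgroup_wall_product.
  apply: IH => //.
  have -> : s i ^ (eval (p1 ++ p2))^-1 =
            (s i ^ (eval p)^-1) ^ (s j ^ (eval p1)^-1).
    by rewrite tE -[RHS]conjgM conj_gen2 conjg1.
  exact: subgroup_conj.
apply: IH => //; apply: leq_ltn_trans sz.
by rewrite size_cat leq_addr.
Qed.

Lemma sub_wall_product : V `<=` wall_product.
Proof.
have [_ Vgen] := V_gen.
apply: (subset_trans Vgen); apply: generated_sub is_subgroup_wall_product _.
move=> t [Vt /reflectionP[p [i tE]]]; rewrite tE in Vt *.
exact: reflection_wall_product.
Qed.

(** The exchange condition for the canonical generators of [V]: by the cocycle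
    identity, a wall of [V] crossed by a product is crossed at one of its
    factors, and reflecting in it cancels that factor. *)
Lemma wall_exchange cs r : (forall c, c \in cs -> wall c) -> V r ->
  crosses (prodg cs) r ->
  exists ds, [/\ forall c, c \in ds -> wall c, (size ds < size cs)%N &
    r * prodg cs = prodg ds].
Proof.
have [Vsub _] := V_gen.
elim: cs r => [|d cs IH] r csw Vr /=; first by rewrite crosses1.
have [Vd d2 dE] : wall d by apply: csw; rewrite mem_head.
have csw' c : c \in cs -> wall c.
  by move=> ccs; apply: csw; rewrite in_cons ccs orbT.
rewrite crossesM dE //; case: eqP => [-> _|_ /=].
  by exists cs; rewrite mulgA d2 mul1g.
move=> /(IH _ csw' (subgroup_conj Vsub Vr Vd))[ds [dsw szds dsE]].
exists (d :: ds); split=> //=.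
  move=> c; rewrite in_cons => /orP[/eqP ->|/dsw//].
  by apply: csw; rewrite mem_head.
by rewrite -dsE conjgE !mulgA mulgV mul1g.
Qed.

(** [V] acts freely on its chambers: an element that stays in the same chamber
    of [V] is trivial.  The first factor [c] of a nonempty product of canonical
    generators crosses its own wall, so the rest must cross this wall again,
    and exchanging rewrites the product with at least two factors less. *)
Lemma uncrossed_eq1 w : V w -> (forall r, V r -> crosses w r = false) -> w = 1.
Proof.
move=> /sub_wall_product[cs csw ->].
have [n] := ubnP (size cs); elim: n => // n IH in cs csw *.
case: cs csw => [//|c cs] csw; rewrite /= ltnS => szn unc.
have [Vc c2 cE] : wall c by apply: csw; rewrite mem_head.
have csw' d : d \in cs -> wall d.
  by move=> dcs; apply: csw; rewrite in_cons dcs orbT.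
have : crosses (prodg cs) c.
  have := unc c Vc; rewrite crossesM cE // eqxx conjgE mulKg.
  by case: crosses.
move=> /(wall_exchange csw' Vc)[ds [dsw szds dsE]].
rewrite dsE in unc *; apply: IH => //; exact: ltn_trans szds szn.
Qed.

End Walls.

(** * Intersection with a special subgroup *)

Section Special.
Variable S1 : {set S}.

Lemma special_subgroupP w : special_subgroup m S1 w ->
  exists2 u, {subset u <= S1} & w = eval u.
Proof.
move: w; apply: generated_sub.
  split.
  - by exists [::].
  - move=> _ _ [u uS ->] [v vS ->]; exists (u ++ v); last by rewrite eval_cat.
    by move=> i; rewrite mem_cat => /orP[/uS|/vS].
  - move=> _ [u uS ->]; exists (rev u); last by rewrite eval_rev.
    by move=> i; rewrite mem_rev => /uS.
move=> _ [i /= iS <-]; exists [:: i]; last by rewrite /= mulg1.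
by move=> j; rewrite inE => /eqP ->.
Qed.

Lemma eval_special u : {subset u <= S1} -> special_subgroup m S1 (eval u).
Proof.
have [G1 GM _] : is_subgroup (special_subgroup m S1).
  exact: is_subgroup_generated.
elim: u => [//|i u IH] uS /=; apply: GM.
  apply: (@sub_generated _ (coxeter_gens m S1)); exists i => //=.
  by apply: uS; rewrite mem_head.
by apply: IH => j ju; apply: uS; rewrite in_cons ju orbT.
Qed.

Lemma reflection_special p i : {subset p <= S1} -> i \in S1 ->
  reflections (special_subgroup m S1) (coxeter_gens m S1) (s i ^ (eval p)^-1).
Proof.
move=> pS iS; exists (s i); first by exists i.
exists (eval p)^-1 => //; have [_ _ GV] : is_subgroup (special_subgroup m S1).
  exact: is_subgroup_generated.
by apply: GV; apply: eval_special.
Qed.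

Lemma reflections_sub_special :
  reflections (special_subgroup m S1) (coxeter_gens m S1) `<=`
  special_subgroup m S1.
Proof.
have Gsub : is_subgroup (special_subgroup m S1).
  exact: is_subgroup_generated.
move=> _ [_ [i iS <-] [g Gg <-]]; apply: (subgroup_conj Gsub _ Gg).
by apply: (@sub_generated _ (coxeter_gens m S1)); exists i.
Qed.

(** Letters of a word in [S1] are deleted, each at the price of a reflection of
    the special subgroup lying in [V], until the word crosses no wall of [V];
    the remaining word then represents [1] by [uncrossed_eq1]. *)
Lemma special_reflection_generated V : reflection_generated V ->
  V `&` special_subgroup m S1 =
  generated (V `&` reflections (special_subgroup m S1) (coxeter_gens m S1)).
Proof.
move=> V_gen; have [Vsub _] := V_gen; apply/seteqP; split; last first.
  apply: generated_sub.
    exact: is_subgroup_setI Vsub (is_subgroup_generated _).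
  by move=> t [Vt /reflections_sub_special].
move=> _ [/[swap] /special_subgroupP[u uS ->]] Vu.
have [n] := ubnP (size u); elim: n => // n IH in u uS Vu *; rewrite ltnS => un.
set H := generated _ in IH *.
have [H1 HM _] : is_subgroup H := is_subgroup_generated _.
have [[r [/crossedP[p [i [q [uE rE]]]] Vr]]|none] :=
  pselect (exists r, r \in crossed u /\ V r); last first.
  rewrite (uncrossed_eq1 V_gen Vu) // => r Vr; rewrite crosses_eval.
  case: (boolP (r \in crossed u)) => [ru|/count_memPn ->//].
  by case: none; exists r.
have pqS : {subset p ++ q <= S1}.
  by move=> j; rewrite mem_cat => jpq; apply: uS; rewrite uE mem_cat in_cons;
     case/orP: jpq => ->; rewrite ?orbT.
rewrite uE eval_delete -rE; apply: HM.
  apply: sub_generated; split=> //; rewrite rE; apply: reflection_special.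
    by move=> j jp; apply: pqS; rewrite mem_cat jp.
  by apply: uS; rewrite uE mem_cat mem_head orbT.
apply: IH => //; last by move: un; rewrite uE !size_cat /= addnS.
have -> : eval (p ++ q) = r^-1 * eval u by rewrite uE eval_delete -rE mulKg.
by have [_ VM VV] := Vsub; apply: (VM) => //; apply: VV.
Qed.

End Special.

(** * Conjugation *)

Lemma conj_reflection t g : reflection_set t -> reflection_set (t ^ g).
Proof.
by move=> [a Sa [h _ <-]]; exists a => //; exists (h * g); rewrite ?conjgM.
Qed.

Lemma reflection_generated_conj V g :
  reflection_generated V -> reflection_generated [set w | V (w ^ g)].
Proof.
move=> [Vsub Vgen]; split; first exact: (is_subgroup_conj g Vsub).
move=> w /= Vw; set H := generated _.
have Hsub : is_subgroup H by exact: is_subgroup_generated.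
have : [set w | H (w ^ g^-1)] (w ^ g); last by rewrite /= conjgK.
have: V `<=` [set w | H (w ^ g^-1)]; last exact.
apply: (subset_trans Vgen).
apply: generated_sub; first exact: (is_subgroup_conj _ Hsub).
move=> t [Vt Rt] /=; apply: sub_generated; split; first by rewrite /= conjgKV.
exact: conj_reflection.
Qed.

Lemma reflection_subgroup_generated V :
  reflection_subgroup setT (coxeter_gens m (finset.setTfor S)) V ->
  reflection_generated V.
Proof.
move=> [_ [T TR ->]]; split; first exact: is_subgroup_generated.
apply: generated_sub; first exact: is_subgroup_generated.
by move=> t Tt; apply: sub_generated; split; [apply: sub_generated|apply: TR].
Qed.

Lemma subgroup_setT V : is_subgroup V -> (forall i, V (s i)) -> V = setT.
Proof.
move=> [V1 VM _] Vs; apply/seteqP; split=> // w _; rewrite -[w]word_ofK.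
by elim: (word_of w) => [//|i u IH] /=; apply: VM.
Qed.

(** With [x = (s i * s j)^l] and [k = 2 l + 1] the relation reads
    [x s i s j x = 1]; since [s j] inverts [x], it becomes
    [x s i x^-1 s j = 1]. *)
Lemma odd_gen_conj i j k : odd k -> m i j = Some k -> exists g, s j = s i ^ g.
Proof.
move=> k_odd mij; have := gen_relation mij.
rewrite -[k]odd_double_half k_odd add1n -addnn -addSn expgnDr expgSr.
set x := (s i * s j) ^+ _ => x1; exists x^-1.
have xj : x ^ s j = x^-1.
  rewrite conjXg -expVgn; congr (_ ^+ _).
  by rewrite conjgE invgM !genV -!mulgA gen2 mulg1.
apply: (mulIg (s j)); rewrite gen2 conjgE invgK -!mulgA.
have -> : x^-1 * s j = s j * x by rewrite -xj conjgE genV -!mulgA gen2 mulg1.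
by rewrite -x1 !mulgA.
Qed.

Lemma gen_conj : odd_angled m -> cox_div_connected m ->
  forall i j, exists g, s j = s i ^ g.
Proof.
move=> m_odd m_conn i j; have /connectP[p ip ->] := m_conn i j.
elim: p i ip => [|k p IH] i /=; first by exists 1; rewrite conjg1.
move=> /andP[ik /IH[g ->]]; move: ik; rewrite /cox_div.
case: eqP => // /eqP ik; case mik : (m i k) => [l|//] _.
have [h ->] := odd_gen_conj (m_odd _ _ _ ik mik) mik.
by exists (h * g); rewrite conjgM.
Qed.

End CoxeterGroup.


Theorem corollary3p2 (S : finType) (m : coxeter_matrix S)
    (S_nonempty : (0 < #|S|)%N)
    (m_odd : odd_angled m)
    (m_conn : cox_div_connected m)
    (V : set (coxeter_group m)) (n : nat)
    (V_refl : reflection_subgroup setT (coxeter_gens m (finset.setTfor S)) V)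
    (n_gt1 : (1 < n)%N)
    (V_index : has_index V setT n)
    (S1 : {set S}) (S1_nonempty : S1 != finset.set0) :
  exists (U : set (coxeter_group m)) (k : nat),
    [/\ reflection_subgroup (special_subgroup m S1) (coxeter_gens m S1) U,
        has_index U (special_subgroup m S1) k & (k <= n)%N].
Proof.
have V_gen := reflection_subgroup_generated V_refl.
have [Vsub _] := V_gen; have [[_ V_proper] _] := V_refl.
have /finset.set0Pn[i iS1] := S1_nonempty.
have [g Vig] : exists g, ~ V (coxeter_gen m i ^ g).
  apply/not_existsP => Vi; apply: V_proper => w _.
  rewrite (subgroup_setT Vsub) // => j.
  have [g ->] := gen_conj m_odd m_conn i j.
  exact: contrapT (Vi g).
pose G := special_subgroup m S1.
have Gsub : is_subgroup G := is_subgroup_generated _.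
have [k Uk kn] := has_index_setI g Vsub Gsub V_index.
exists ([set w | V (w ^ g)] `&` G), k; split=> //; split.
  split; first exact: subIsetr.
  move=> GU; have [|Vi _] := GU (coxeter_gen m i).
    by apply: sub_generated; exists i.
  exact: Vig.
exists ([set w | V (w ^ g)] `&` reflections G (coxeter_gens m S1)).
  exact: subIsetr.
exact/special_reflection_generated/reflection_generated_conj.
Qed.
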